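(* Let $b\ge 2$ and let $G$ be a grid-labelled graph of type $(2,b)$ with at least one edge. Then $\rho(G)$ is separable if and only if $D(G)=D(\Gamma(G))$.
   Context: A grid-labelled graph of type $(a,b)$ is a simple graph $G$ whose vertex set is the grid $[a]\times[b]$; $D(G)$ is its degree matrix and $L(G)=D(G)-A(G)$ its combinatorial Laplacian. If $G$ has $m\ge1$ edges, $\rho(G)=L(G)/(2m)$ is a density matrix on $\mathbb{C}^a\otimes\mathbb{C}^b$ with vertex $(i,j)$ corresponding to $|i\rangle\otimes|j\rangle$. Separable means a convex combination of tensor products of density matrices. The partial transpose $\Gamma(G)$ is the grid-labelled graph of type $(a,b)$ with edge set $\{\{(k,j),(i,l)\}:\{(i,j),(k,l)\}\in E(G)\}$. *)

(* Defs.v *)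
From HB Require Import structures.
From mathcomp Require Import all_boot all_order all_algebra.
Set Implicit Arguments. Unset Strict Implicit. Unset Printing Implicit Defensive.
Import Order.TTheory GRing.Theory Num.Theory.
Local Open Scope ring_scope.

(* Vertex set of a grid-labelled graph of type (a,b): the grid [a] x [b]. *)
Definition gridV (a b : nat) : finType := ('I_a * 'I_b)%type.

(* A simple graph on a finite vertex type T, given by its adjacency relation. *)
Definition simple_graph (T : finType) (e : rel T) : Prop :=
  symmetric e /\ irreflexive e.

(* Degree of a vertex. *)
Definition deg (T : finType) (e : rel T) (u : T) : nat := #|[set v | e u v]|.

(* Edge set as a set of 2-element vertex sets, and its cardinality m. *)
Definition edges (T : finType) (e : rel T) : {set {set T}} :=
  [set [set p.1; p.2] | p : T * T & e p.1 p.2].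
Definition nedges (T : finType) (e : rel T) : nat := #|edges e|.

(* Partial transpose Gamma(G): {(i,j),(k,l)} in E(G) gives {(k,j),(i,l)}. *)
Definition gamma (a b : nat) (e : rel (gridV a b)) : rel (gridV a b) :=
  fun u v => e (v.1, u.2) (u.1, v.2).

(* Identification of the basis index of C^a (x) C^b (= C^(a*b)) with the grid:
   index k corresponds to the vertex (i,j), i.e. to |i> (x) |j>. *)
Definition pidx (a b : nat) (k : 'I_(a * b)) : gridV a b :=
  enum_val (cast_ord (esym (mxvec_cast a b)) k).

Section Mats.
Variable C : numClosedFieldType.

Definition degmx (a b : nat) (e : rel (gridV a b)) : 'M[C]_(a * b) :=
  \matrix_(k, l) ((k == l)%:R * (deg e (pidx k))%:R).

Definition adjmx (a b : nat) (e : rel (gridV a b)) : 'M[C]_(a * b) :=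
  \matrix_(k, l) (e (pidx k) (pidx l))%:R.

Definition lapmx (a b : nat) (e : rel (gridV a b)) : 'M[C]_(a * b) :=
  degmx e - adjmx e.

(* rho(G) = L(G) / (2m) *)
Definition rho (a b : nat) (e : rel (gridV a b)) : 'M[C]_(a * b) :=
  ((2 * nedges e)%:R)^-1 *: lapmx e.

(* Conjugate transpose. *)
Definition adjoint (m n : nat) (A : 'M[C]_(m, n)) : 'M[C]_(n, m) :=
  map_mx (fun z => z^*) A^T.

(* Density matrix: Hermitian, positive semidefinite, trace one. *)
Definition density (n : nat) (A : 'M[C]_n) : Prop :=
  adjoint A = A /\
  (forall v : 'rV[C]_n, 0 <= (v *m A *m adjoint v) 0 0) /\
  \tr A = 1.

(* Kronecker (tensor) product A (x) B, consistent with pidx. *)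
Definition kron (a b : nat) (A : 'M[C]_a) (B : 'M[C]_b) : 'M[C]_(a * b) :=
  \matrix_(k, l) (A (pidx k).1 (pidx l).1 * B (pidx k).2 (pidx l).2).

(* Separable: a (finite) convex combination of tensor products of density
   matrices. *)
Definition separable (a b : nat) (R : 'M[C]_(a * b)) : Prop :=
  exists (N : nat) (p : 'I_N -> C) (A : 'I_N -> 'M[C]_a) (B : 'I_N -> 'M[C]_b),
    [/\ (forall k, 0 <= p k), \sum_k p k = 1,
        (forall k, density (A k) /\ density (B k)) &
        R = \sum_k p k *: kron (A k) (B k)].
End Mats.

(* Main.v *)
(** Necessity: the entries of [L(G)], transposed in the first factor, sum to [0],
    and their row sums are the differences of the degrees in [G] and [Gamma(G)].
    For a separable state this total is a convex combination of the products
    [<1|A_k|1> <1|B_k|1>] of nonnegative numbers, so in each term [A_k] or [B_k]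
    kills the all-ones vector; hence all the row sums vanish.

    Sufficiency: edges inside a row of the grid contribute product states.  Each
    edge [{(0,j),(1,l)}] is read as an arc [j -> l] on [[b]]; equality of the
    degree matrices says that every vertex has as many outgoing as incoming
    arcs.  Thus there is a permutation [s] of the arcs such that the source of
    [s x] is the target of [x], and diagonalising its permutation matrix
    decomposes the contribution of these edges into product states. *)

Require Import Defs.
From HB Require Import structures.
From mathcomp Require Import all_boot all_order all_algebra all_fingroup.
From mathcomp Require Import ring.
Set Implicit Arguments. Unset Strict Implicit. Unset Printing Implicit Defensive.
Import Order.TTheory GRing.Theory Num.Theory.
Local Open Scope ring_scope.

(** * Counting edges by degrees *)

Lemma sum_deg (T : finType) (e : rel T) :
  simple_graph e -> (\sum_u deg e u = 2 * nedges e)%N.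
Proof.
move=> [sym_e irr_e]; transitivity (\sum_(p : T * T | e p.1 p.2) 1)%N.
  rewrite -(pair_big_dep xpredT (fun u v => e u v) (fun _ _ => 1%N)) /=.
  by apply: eq_bigr => u _; rewrite sum1dep_card.
(* Over each edge lie exactly two ordered pairs, distinct because [e] is irreflexive. *)
rewrite (partition_big_imset (fun p : T * T => [set p.1; p.2])) /=.
rewrite mulnC -sum_nat_const; apply: eq_big => S.
  by apply/imsetP/imsetP => -[p ep ->]; exists p; move: ep; rewrite ?inE ?unfold_in.
move/imsetP=> [[x y] /= exy ->{S}].
have neq_xy : x != y by apply/eqP => xy; move: exy; rewrite xy unfold_in /= irr_e.
have exy' : e x y by exact: exy.
rewrite (eq_bigl (mem [set (x, y); (y, x)])) => [|[u v]] /=.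
  by rewrite sum1_card cards2 xpair_eqE (negPf neq_xy).
rewrite !inE !xpair_eqE /=; apply/andP/orP => [[euv /eqP Euv]|].
  have /set2P u_xy : u \in [set x; y] by rewrite -Euv !inE eqxx.
  have /set2P v_xy : v \in [set x; y] by rewrite -Euv !inE eqxx orbT.
  move: euv; rewrite unfold_in /=.
  by case: u_xy v_xy => -> [] ->; rewrite ?irr_e // !eqxx; [left | right].
case=> /andP[/eqP-> /eqP->]; first by rewrite unfold_in /= exy' eqxx.
by rewrite unfold_in /= sym_e exy'; split => //; rewrite setUC.
Qed.

Lemma deg_sum (T : finType) (e : rel T) (u : T) : deg e u = (\sum_v e u v)%N.
Proof.
rewrite /deg -sum1_card big_mkcond; apply: eq_bigr => v _.
by rewrite inE; case: (e u v).
Qed.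

Lemma natr_deg (R : pzRingType) (T : finType) (e : rel T) (u : T) :
  (deg e u)%:R = \sum_v (e u v)%:R :> R.
Proof. by rewrite deg_sum natr_sum. Qed.

(** * Degrees and Laplacian entries under partial transposition *)

Section Grid.
Variables a b : nat.
Implicit Type e : rel (gridV a b).

Lemma pidxK (u : gridV a b) : pidx (mxvec_index u.1 u.2) = u.
Proof. by rewrite /pidx /mxvec_index cast_ordK enum_rankK; case: u. Qed.

Lemma pidx_bij : bijective (@pidx a b).
Proof.
exists (fun u : gridV a b => mxvec_index u.1 u.2) => [k|]; last exact: pidxK.
by case/mxvec_indexP: k => i j; rewrite (pidxK (i, j)).
Qed.

(** Swapping the first coordinates of two vertices is an involution [h] on ordered pairs that
    carries adjacency in [gamma e] to adjacency in [e]. *)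
Lemma sum_deg_gamma e : (\sum_u deg (gamma e) u = \sum_u deg e u)%N.
Proof.
have degE (f : rel (gridV a b)) :
    (\sum_u deg f u = \sum_(p : gridV a b * gridV a b) f p.1 p.2)%N.
  rewrite -(pair_bigA _ (fun u v => f u v : nat)) /=; apply: eq_bigr => u _.
  exact: deg_sum.
pose h (p : gridV a b * gridV a b) : gridV a b * gridV a b :=
  ((p.2.1, p.1.2), (p.1.1, p.2.2)).
rewrite !degE [RHS](reindex h) //; exists h => [] [[i j] [k l]] _ //.
Qed.

Lemma degmx_eq (C : numClosedFieldType) e f :
  degmx C e = degmx C f <-> deg e =1 deg f.
Proof.
split=> [E u|E]; last by apply/matrixP => k l; rewrite !mxE E.
move/matrixP/(_ (mxvec_index u.1 u.2) (mxvec_index u.1 u.2)): E.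
by rewrite !mxE pidxK eqxx !mul1r => /eqP; rewrite eqr_nat => /eqP.
Qed.

Lemma lapmxE (C : numClosedFieldType) e (u v : gridV a b) :
  lapmx C e (mxvec_index u.1 u.2) (mxvec_index v.1 v.2)
  = (u == v)%:R * (deg e u)%:R - (e u v)%:R.
Proof.
rewrite !mxE !pidxK; congr (_%:R * _ - _).
by rewrite -(bij_eq pidx_bij) !pidxK.
Qed.

(** The left side is the row sum at [u] of the Laplacian transposed in its first factor. The
    diagonal is unmoved and gives the degree in [e]; the adjacency part becomes that of
    [gamma e]. *)
Lemma lapmx_partial_transpose_sum (C : numClosedFieldType) e (u : gridV a b) :
  \sum_(v : gridV a b)
     lapmx C e (mxvec_index v.1 u.2) (mxvec_index u.1 v.2)
  = (deg e u)%:R - (deg (gamma e) u)%:R.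
Proof.
under eq_bigr => v _ do rewrite (lapmxE _ _ (v.1, u.2) (u.1, v.2)).
rewrite sumrB -(natr_deg _ (gamma e)); congr (_ - _).
rewrite (bigD1 u) //= eqxx mul1r [X in _ + X]big1 ?addr0 => [|[i j] /=].
  by case: u.
case: u => k l; rewrite !xpair_eqE /= => neq.
by rewrite [l == j]eq_sym (negPf neq) mul0r.
Qed.

End Grid.

(** * Null vectors of density matrices *)

Section Density.
Variables (C : numClosedFieldType) (n : nat).
Implicit Types (A : 'M[C]_n) (u v : 'rV[C]_n).

Lemma quad_formE A u v :
  (u *m A *m adjoint v) 0 0 = \sum_j (\sum_i u 0 i * A i j) * (v 0 j)^*.
Proof. by rewrite !mxE; apply: eq_bigr => j _; rewrite !mxE. Qed.

(** If [w = v *m A] were nonzero, a small real step from [v] along [- w] would make the quadratic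
    form negative: its value there is [s ^+ 2 * q - 2 * s * N], with [N] the squared norm of [w]. *)
Lemma density_quad0 A v : density A -> (v *m A *m adjoint v) 0 0 = 0 -> v *m A = 0.
Proof.
case=> [herm [pos _]] q0.
pose w := v *m A; pose N := (w *m adjoint w) 0 0.
pose q := (w *m A *m adjoint w) 0 0.
have NE : N = \sum_j `|w 0 j| ^+ 2.
  by rewrite /N mxE; apply: eq_bigr => j _; rewrite !mxE normCK.
have N_ge0 : 0 <= N by rewrite NE; apply: sumr_ge0 => j _; rewrite exprn_ge0.
have q_ge0 : 0 <= q by apply: pos.
have adjw : adjoint w = A *m adjoint v.
  by rewrite /w -[in RHS]herm /adjoint trmx_mul map_mxM.
have key s : s \is Num.real -> 0 <= s ^+ 2 * q - 2 * s * N.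
  move=> s_real; have := pos (v - s *: w).
  have -> : adjoint (v - s *: w) = adjoint v - s *: adjoint w.
    by apply/matrixP => i j; rewrite !mxE rmorphB rmorphM /= (CrealP s_real).
  rewrite mulmxBl mulmxBr !mulmxBl -!scalemxAl -!scalemxAr.
  rewrite -[w *m A *m adjoint v]mulmxA -adjw -/w.
  have entryE (X Y Z W : 'M[C]_1) :
      (X - s *: Y - (s *: Z - s *: (s *: W))) 0 0
      = X 0 0 - s * Y 0 0 - (s * Z 0 0 - s * (s * W 0 0)) by rewrite !mxE.
  by rewrite entryE q0 -/N -/q; congr (0 <= _); ring.
have q1_gt0 : 0 < q + 1 by rewrite ltr_wpDl.
(* This step size makes the value a negative multiple of [N ^+ 2]; the added 1 keeps the denominator
   positive when [q] is 0. *)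
have /key : N / (q + 1) \is Num.real by rewrite rpred_div ?ger0_real // ltW.
have -> : (N / (q + 1)) ^+ 2 * q - 2 * (N / (q + 1)) * N
    = - (N ^+ 2 * ((q + 2) / (q + 1) ^+ 2)) by field; rewrite gt_eqF.
have c_gt0 : 0 < (q + 2) / (q + 1) ^+ 2 by rewrite divr_gt0 ?exprn_gt0 ?ltr_wpDl.
rewrite oppr_ge0 (pmulr_lle0 _ c_gt0) => N2_le0.
have N0 : N = 0 by apply/eqP; rewrite -sqrf_eq0 eq_le exprn_ge0 // andbT.
apply/rowP => j; rewrite [RHS]mxE; apply/eqP; rewrite -normr_eq0 -sqrf_eq0.
move/eqP: N0; rewrite NE psumr_eq0 => [/allP/(_ j (mem_index_enum _))//|i _].
by rewrite exprn_ge0.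
Qed.

Lemma density_sum_ge0 A : density A -> 0 <= \sum_j \sum_i A i j.
Proof.
case=> _ [/(_ (const_mx 1)) + _]; rewrite quad_formE.
congr (0 <= _); apply: eq_bigr => j _; rewrite mxE conjC1 mulr1.
by apply: eq_bigr => i _; rewrite mxE mul1r.
Qed.

(** The sum of all entries is the quadratic form at the all-ones vector, so that vector is killed
    and column sums vanish; Hermitian symmetry transfers this to row sums. *)
Lemma density_sum_eq0 A : density A -> \sum_j \sum_i A i j = 0 ->
  (forall j, \sum_i A i j = 0) /\ (forall i, \sum_j A i j = 0).
Proof.
move=> dA sum0.
have col0 j : \sum_i A i j = 0.
  have /matrixP/(_ 0 j) : const_mx 1 *m A = 0 :> 'rV[C]_n.
    apply: density_quad0 => //; rewrite quad_formE -[RHS]sum0.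
    apply: eq_bigr => k _; rewrite mxE conjC1 mulr1.
    by apply: eq_bigr => i _; rewrite mxE mul1r.
  rewrite !mxE => E; rewrite -[RHS]E.
  by apply: eq_bigr => i _; rewrite mxE mul1r.
split=> // i; transitivity ((\sum_j A j i)^*); last by rewrite col0 conjC0.
rewrite rmorph_sum; apply: eq_bigr => j _; have [herm _] := dA.
by rewrite -[in LHS]herm !mxE.
Qed.

End Density.

(** * Necessity of the degree condition *)

Lemma separable_degmx (C : numClosedFieldType) (a b : nat) (e : rel (gridV a b)) :
  (0 < nedges e)%N -> separable (rho C e) -> degmx C e = degmx C (gamma e).
Proof.
move=> m_gt0 [N [p [A [B [p_ge0 _ dAB rhoE]]]]].
pose c : C := ((2 * nedges e)%:R)^-1.
have c_neq0 : c != 0 by rewrite invr_eq0 pnatr_eq0 muln_eq0 -lt0n.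
(* Partial transposition replaces [A k] by its transpose, hence a column sum of [A k] against a row
   sum of [B k]. *)
have sumE (u : gridV a b) : c * ((deg e u)%:R - (deg (gamma e) u)%:R)
    = \sum_k p k * ((\sum_i A k i u.1) * (\sum_j B k u.2 j)).
  rewrite -lapmx_partial_transpose_sum mulr_sumr.
  transitivity (\sum_(v : gridV a b) \sum_k p k * (A k v.1 u.1 * B k u.2 v.2)).
    apply: eq_bigr => v _.
    have /matrixP/(_ (mxvec_index v.1 u.2) (mxvec_index u.1 v.2)) := rhoE.
    rewrite [LHS]mxE => ->; rewrite summxE; apply: eq_bigr => k _.
    by rewrite !mxE (pidxK (v.1, u.2)) (pidxK (u.1, v.2)).
  rewrite exchange_big; apply: eq_bigr => k _; rewrite -mulr_sumr; congr (_ * _).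
  rewrite big_distrlr pair_bigA; exact: eq_bigr.
have tot : \sum_k p k * ((\sum_j \sum_i A k i j) * (\sum_j \sum_i B k i j)) = 0.
  transitivity (\sum_(u : gridV a b) c * ((deg e u)%:R - (deg (gamma e) u)%:R)).
    under [RHS]eq_bigr do rewrite sumE; rewrite exchange_big.
    apply: eq_bigr => k _; rewrite -mulr_sumr; congr (_ * _).
    by rewrite [X in _ * X]exchange_big big_distrlr pair_bigA.
  by rewrite -mulr_sumr sumrB -!natr_sum sum_deg_gamma subrr mulr0.
apply/degmx_eq => u; apply/eqP; rewrite -(eqr_nat C) -subr_eq0.
rewrite -(mulrI_eq0 _ (mulfI c_neq0)) sumE big1 // => k _.
have [dA dB] := dAB k.
(* Nonnegative terms of total 0 all vanish, so the weight or one of the two entry sums is 0, and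
   each case kills the [k]-th term at [u]. *)
move/eqP: tot; rewrite psumr_eq0 => [/allP/(_ k (mem_index_enum _))|i _];
  last first.
  by have [dAi dBi] := dAB i; rewrite !mulr_ge0 ?density_sum_ge0.
rewrite /= !mulf_eq0 => /or3P[/eqP->|/eqP/(density_sum_eq0 dA)[-> _]|
    /eqP/(density_sum_eq0 dB)[_ ->]];
  by rewrite ?mul0r ?mulr0.
Qed.

(** * The cone of unnormalised separable matrices *)

Section SeparableCone.
Variable C : numClosedFieldType.

Definition outer n (u : 'rV[C]_n) : 'M[C]_n := \matrix_(i, j) (u 0 i * (u 0 j)^*).

Lemma outerE n (u : 'rV[C]_n) i j : outer u i j = u 0 i * (u 0 j)^*.
Proof. exact: mxE. Qed.

Lemma outer0 n : outer (0 : 'rV[C]_n) = 0.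
Proof. by apply/matrixP => i j; rewrite !mxE mul0r. Qed.

Lemma tr_outer n (u : 'rV[C]_n) : \tr (outer u) = \sum_i `|u 0 i| ^+ 2.
Proof. by apply: eq_bigr => i _; rewrite mxE normCK. Qed.

Lemma tr_outer_ge0 n (u : 'rV[C]_n) : 0 <= \tr (outer u).
Proof. by rewrite tr_outer sumr_ge0 // => i _; rewrite exprn_ge0. Qed.

Lemma tr_outer_eq0 n (u : 'rV[C]_n) : (\tr (outer u) == 0) = (u == 0).
Proof.
apply/idP/eqP => [|->]; last by rewrite outer0 mxtrace0.
rewrite tr_outer psumr_eq0 => [/allP u0|i _]; last by rewrite exprn_ge0.
apply/rowP => i; rewrite mxE; apply/eqP.
by have := u0 i (mem_index_enum i); rewrite /= sqrf_eq0 normr_eq0.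
Qed.

Lemma outerZ n (c : C) (u : 'rV[C]_n) : outer (c *: u) = `|c| ^+ 2 *: outer u.
Proof. by apply/matrixP => i j; rewrite !mxE rmorphM normCK mulrACA. Qed.

Lemma density_outer n (u : 'rV[C]_n) :
  u != 0 -> density ((\tr (outer u))^-1 *: outer u).
Proof.
move=> u_neq0; have t_real := ger0_real (tr_outer_ge0 u).
split; last split.
- apply/matrixP => i j; rewrite !mxE rmorphM rmorphM /= conjCK fmorphV /=.
  by rewrite (CrealP t_real) [X in _ * X]mulrC.
- move=> v; rewrite quad_formE.
  (* The form of a rank-one matrix is a squared modulus, hence nonnegative. *)
  suff -> : \sum_j (\sum_i v 0 i * ((\tr (outer u))^-1 *: outer u) i j) * (v 0 j)^*
      = (\tr (outer u))^-1 * `|\sum_i v 0 i * u 0 i| ^+ 2.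
    by rewrite mulr_ge0 ?invr_ge0 ?tr_outer_ge0 ?exprn_ge0.
  rewrite normCK rmorph_sum /= mulrA mulr_sumr; apply: eq_bigr => j _.
  have -> : \sum_i v 0 i * ((\tr (outer u))^-1 *: outer u) i j
      = (\tr (outer u))^-1 * (\sum_i v 0 i * u 0 i) * (u 0 j)^*.
    rewrite mulr_sumr mulr_suml; apply: eq_bigr => i _; rewrite !mxE; ring.
  by rewrite rmorphM /=; ring.
- by rewrite mxtraceZ mulVf // tr_outer_eq0.
Qed.

(* The zero vector has no normalisation; any density matrix will do there. *)
Definition normalized_outer n (i0 : 'I_n) (u : 'rV[C]_n) : 'M[C]_n :=
  let w := if u == 0 then delta_mx 0 i0 else u in (\tr (outer w))^-1 *: outer w.

Lemma density_normalized_outer n (i0 : 'I_n) u : density (normalized_outer i0 u).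
Proof.
apply: density_outer; have [_|//] := eqVneq u 0.
by apply/eqP => /rowP/(_ i0)/eqP; rewrite !mxE !eqxx oner_eq0.
Qed.

Lemma outer_normalized n (i0 : 'I_n) u :
  outer u = \tr (outer u) *: normalized_outer i0 u.
Proof.
rewrite /normalized_outer; have [->|u_neq0] := eqVneq u 0.
  by rewrite outer0 mxtrace0 scale0r.
by rewrite scalerA mulfV ?scale1r // tr_outer_eq0.
Qed.

Variables a b : nat.

Lemma kronE (A : 'M[C]_a) (B : 'M[C]_b) i j k l :
  kron A B (mxvec_index i j) (mxvec_index k l) = A i k * B j l.
Proof. by rewrite mxE (pidxK (i, j)) (pidxK (k, l)). Qed.

Lemma kronZZ (c d : C) (A : 'M[C]_a) (B : 'M[C]_b) :
  kron (c *: A) (d *: B) = (c * d) *: kron A B.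
Proof. by apply/matrixP => k l; rewrite !mxE mulrACA. Qed.

Lemma tr_kron (A : 'M[C]_a) (B : 'M[C]_b) : \tr (kron A B) = \tr A * \tr B.
Proof.
rewrite /mxtrace big_distrlr pair_bigA [RHS](reindex (@pidx a b)) /=.
  by apply: eq_bigr => k _; rewrite mxE.
exact/onW_bij/pidx_bij.
Qed.

(** Dropping normalisation makes sums and nonnegative multiples immediate; traces are restored once,
    in [separable_of_cone]. *)
Definition separable_cone (X : 'M[C]_(a * b)) : Prop :=
  exists s : seq ('rV[C]_a * 'rV[C]_b),
    X = \sum_(x <- s) kron (outer x.1) (outer x.2).

Lemma separable_cone0 : separable_cone 0.
Proof. by exists [::]; rewrite big_nil. Qed.

Lemma separable_coneD X Y :
  separable_cone X -> separable_cone Y -> separable_cone (X + Y).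
Proof. by move=> [s ->] [t ->]; exists (s ++ t); rewrite big_cat. Qed.

Lemma separable_cone_sum (I : finType) (F : I -> 'M[C]_(a * b)) :
  (forall i, separable_cone (F i)) -> separable_cone (\sum_i F i).
Proof.
move=> coneF; apply: big_ind => //.
  exact: separable_cone0.
exact: separable_coneD.
Qed.

Lemma separable_coneZ c X : 0 <= c -> separable_cone X -> separable_cone (c *: X).
Proof.
move=> c_ge0 [s ->]; exists [seq (sqrtC c *: x.1, x.2) | x <- s].
rewrite big_map scaler_sumr; apply: eq_bigr => x _ /=.
rewrite outerZ -[outer x.2 in RHS]scale1r kronZZ mulr1; congr (_ *: _).
by rewrite ger0_norm ?sqrtC_ge0 // sqrtCK.
Qed.

Lemma separable_cone_outer u v : separable_cone (kron (outer u) (outer v)).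
Proof. by exists [:: (u, v)]; rewrite big_seq1. Qed.

(** The weight of each product term is its trace, so the weights add up to [\tr X]. Positivity of
    [a] and [b] supplies the default states used for zero vectors. *)
Lemma separable_of_cone X :
  (0 < a)%N -> (0 < b)%N -> separable_cone X -> \tr X = 1 -> separable X.
Proof.
move=> a_gt0 b_gt0 [s XE] trX.
pose i0 := Ordinal a_gt0; pose j0 := Ordinal b_gt0.
pose x k := tnth (in_tuple s) k.
exists (size s), (fun k => \tr (outer (x k).1) * \tr (outer (x k).2)),
  (fun k => normalized_outer i0 (x k).1), (fun k => normalized_outer j0 (x k).2).
have XE' : X = \sum_k kron (outer (x k).1) (outer (x k).2) by rewrite XE big_tnth.
split=> [k||k|].
- by rewrite mulr_ge0 ?tr_outer_ge0.
- rewrite -trX XE' raddf_sum /=; apply: eq_bigr => k _; exact: esym (tr_kron _ _).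
- by split; apply: density_normalized_outer.
- rewrite XE'; apply: eq_bigr => k _.
  rewrite (outer_normalized i0 (x k).1) (outer_normalized j0 (x k).2) kronZZ.
  by rewrite -!outer_normalized.
Qed.

End SeparableCone.

(** * Product decomposition from a permutation matrix *)

Lemma sum_delta (R : pzRingType) (I : finType) (j : I) (F : I -> R) :
  \sum_i (i == j)%:R * F i = F j.
Proof.
rewrite (bigD1 j) //= eqxx mul1r big1 ?addr0 // => i /negPf->.
by rewrite mul0r.
Qed.

Lemma perm_mx_unitary (C : numClosedFieldType) n (s : 'S_n) :
  (perm_mx s : 'M[C]_n) \is unitarymx.
Proof.
by apply/unitarymxP; rewrite tr_perm_mx map_perm_mx -perm_mxM mulgV perm_mx1.
Qed.

Lemma perm_mx_normal (C : numClosedFieldType) n (s : 'S_n) :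
  (perm_mx s : 'M[C]_n) \is normalmx.
Proof.
by apply/normalmxP; rewrite tr_perm_mx map_perm_mx -!perm_mxM mulgV mulVg.
Qed.

(* Diagonalising the permutation matrix of s as sum_k d_k |w_k><w_k| writes the
   block matrix [[1, -S], [-S^*, 1]] as the sum over k of the tensor products of
   [[1, -d_k], [-d_k^*, |d_k|^2]] with |w_k><w_k|, then src is applied. *)
Lemma separable_cone_perm (C : numClosedFieldType) (b n : nat) (src : 'I_n -> 'I_b)
    (s : 'S_n) (X : 'M[C]_(2 * b)) :
  (forall u v : gridV 2 b, X (mxvec_index u.1 u.2) (mxvec_index v.1 v.2) =
    if u.1 == v.1 then \sum_x (src x == u.2)%:R * (src x == v.2)%:R
    else if u.1 == 0 then - \sum_x (src x == u.2)%:R * (src (s x) == v.2)%:R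
    else - \sum_x (src (s x) == u.2)%:R * (src x == v.2)%:R) ->
  separable_cone X.
Proof.
move=> XE; pose T : 'M[C]_n := perm_mx s.
pose P := spectralmx T; pose d := spectral_diag T.
have unitP : P \is unitarymx := spectral_unitarymx T.
have TE : T = map_mx Num.conj P^T *m diag_mx d *m P.
  by rewrite -invmx_unitary //; apply/orthomx_spectralP/perm_mx_normal.
have PP : map_mx Num.conj P^T *m P = 1%:M by apply/mulmx1C/unitarymxP.
have specE (c : 'rV[C]_n) x y :
    \sum_k (P k x)^* * c 0 k * P k y = (map_mx Num.conj P^T *m diag_mx c *m P) x y.
  rewrite mul_mx_diag mxE; apply: eq_bigr => k _; by rewrite !mxE.
have spec1 x y : \sum_k (P k x)^* * 1 * P k y = (x == y)%:R.
  have /matrixP/(_ x y) := PP; rewrite !mxE => <-.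
  by apply: eq_bigr => k _; rewrite !mxE mulr1.
have specd x y : \sum_k (P k x)^* * d 0 k * P k y = (s x == y)%:R.
  by rewrite specE -TE !mxE.
have specdC x y : \sum_k (P k x)^* * (d 0 k)^* * P k y = (s y == x)%:R.
  rewrite -[RHS]conjC_nat -specd rmorph_sum; apply: eq_bigr => k _.
  by rewrite !rmorphM /= conjCK; ring.
(* As [T] times its adjoint is the identity, the weights [|d_k|^2] also resolve the identity; this
   serves the lower diagonal block. *)
have specdd x y : \sum_k (P k x)^* * (d 0 k * (d 0 k)^*) * P k y = (x == y)%:R.
  have := specE (\row_k (d 0 k * (d 0 k)^*)) x y.
  under eq_bigr do rewrite mxE; move=> ->.
  have /unitarymxP := perm_mx_unitary C s; rewrite -/T.
  suff -> : T *m map_mx Num.conj T^T =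
     map_mx Num.conj P^T *m diag_mx (\row_k (d 0 k * (d 0 k)^*)) *m P.
    by move->; rewrite mxE.
  have -> : map_mx Num.conj T^T =
      map_mx Num.conj P^T *m diag_mx (map_mx Num.conj d) *m P.
    rewrite TE !trmx_mul !map_mxM tr_diag_mx map_diag_mx mulmxA.
    congr (_ *m _ *m _); apply/matrixP => i j; rewrite !mxE; exact: conjCK.
  rewrite TE -!mulmxA [P *m (_ *m _)]mulmxA.
  have /unitarymxP -> := unitP; rewrite mul1mx [diag_mx d *m _]mulmxA mulmx_diag.
  by congr (_ *m (diag_mx _ *m _)); apply/rowP => k; rewrite !mxE.
(* [w k] is the conjugated [k]-th row of [P] pushed forward along [src]; [outer (z k)] is the 2 by 2
   block with entries 1, [- d_k], its conjugate and [|d_k|^2]. *)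
pose w k : 'rV[C]_b := \row_j \sum_x (src x == j)%:R * (P k x)^*.
pose z k : 'rV[C]_2 := \row_i if i == 0 then 1 else - (d 0 k)^*.
have sumE (c : 'I_n -> C) (M : 'I_n -> 'I_n -> C) j l :
    (forall x y, \sum_k (P k x)^* * c k * P k y = M x y) ->
    \sum_k c k * outer (w k) j l
    = \sum_x \sum_y (src x == j)%:R * (src y == l)%:R * M x y.
  move=> cM; transitivity (\sum_k \sum_x \sum_y
      (src x == j)%:R * (src y == l)%:R * ((P k x)^* * c k * P k y)).
    apply: eq_bigr => k _; rewrite !mxE rmorph_sum big_distrlr mulr_sumr.
    apply: eq_bigr => x _; rewrite mulr_sumr; apply: eq_bigr => y _.
    by rewrite rmorphM /= conjC_nat conjCK; ring.
  rewrite exchange_big; apply: eq_bigr => x _; rewrite exchange_big.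
  by apply: eq_bigr => y _; rewrite -mulr_sumr cM.
suff -> : X = \sum_k kron (outer (z k)) (outer (w k)).
  by apply: separable_cone_sum => k; apply: separable_cone_outer.
apply/matrixP => /mxvec_indexP[i j] /mxvec_indexP[i' l].
rewrite (XE (i, j) (i', l)) /= summxE.
under [RHS]eq_bigr => k _ do rewrite kronE [outer (z k) _ _]outerE.
have z0 k : z k 0 0 = 1 by rewrite mxE eqxx.
have z1 k i1 : (i1 == 0) = false -> z k 0 i1 = - (d 0 k)^* by rewrite mxE => ->.
have [ii'|neq_ii'] := eqVneq i i'.
  rewrite -ii'.
  have zz x y : \sum_k (P k x)^* * (z k 0 i * (z k 0 i)^*) * P k y
      = (x == y)%:R.
    have [->|/negPf i_neq0] := eqVneq i 0.
      by rewrite -spec1; apply: eq_bigr => k _; rewrite z0 conjC1 mulr1.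
    by rewrite -specdd; apply: eq_bigr => k _; rewrite z1 // rmorphN /= conjCK; ring.
  rewrite (sumE _ _ _ _ zz); apply: eq_bigr => x _.
  rewrite -(sum_delta x (fun y => (src x == j)%:R * (src y == l)%:R)).
  by apply: eq_bigr => y _; rewrite [x == y]eq_sym mulrC.
have [i0|/negPf i_neq0] := eqVneq i 0.
  have zz x y : \sum_k (P k x)^* * (z k 0 i * (z k 0 i')^*) * P k y = - (s x == y)%:R.
    rewrite -specd -sumrN; apply: eq_bigr => k _.
    by rewrite i0 z0 z1 ?rmorphN /= ?conjCK; [ring | apply/negbTE; rewrite eq_sym -i0].
  rewrite (sumE _ _ _ _ zz) -sumrN; apply: eq_bigr => x _.
  rewrite -(sum_delta (s x) (fun y => (src x == j)%:R * (src y == l)%:R)) -sumrN.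
  by apply: eq_bigr => y _; rewrite [s x == y]eq_sym mulrN mulrC.
have i'0 : i' = 0.
  by case: i i' i_neq0 neq_ii' => [[|[|//]] ?] [[|[|//]] ?] //= _ _; apply/val_inj.
have zz x y : \sum_k (P k x)^* * (z k 0 i * (z k 0 i')^*) * P k y = - (s y == x)%:R.
  rewrite -specdC -sumrN; apply: eq_bigr => k _.
  by rewrite i'0 z0 z1 // conjC1; ring.
rewrite (sumE _ _ _ _ zz) -sumrN exchange_big; apply: eq_bigr => y _.
rewrite -(sum_delta (s y) (fun x => (src x == j)%:R * (src y == l)%:R)) -sumrN.
by apply: eq_bigr => x _; rewrite [s y == x]eq_sym mulrN mulrC.
Qed.

(** * Edge decomposition and balanced arcs *)

(** A Laplacian is the sum of rank-one matrices of its edges; the factor 1/2 compensates for meeting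
    each edge in both orders. *)
Lemma sum_edge_outer (C : numClosedFieldType) (b : nat) (f : rel 'I_b) j l :
  symmetric f ->
  \sum_x \sum_y ((f x y)%:R / 2) * outer (delta_mx 0 x - delta_mx 0 y : 'rV[C]_b) j l
  = (j == l)%:R * (\sum_x (f j x)%:R) - (f j l)%:R.
Proof.
move=> sym_f; pose g x y : C := (f x y)%:R / 2.
have gC x y : g x y = g y x by rewrite /g sym_f.
transitivity (\sum_x ((x == j)%:R * ((x == l)%:R * \sum_y g x y)
    - (x == j)%:R * \sum_y (y == l)%:R * g x y
    - (x == l)%:R * \sum_y (y == j)%:R * g x y)
    + \sum_x \sum_y (x == j)%:R * ((x == l)%:R * g y x)).
  rewrite [X in _ + X]exchange_big -big_split; apply: eq_bigr => x _ /=.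
  rewrite !mulr_sumr -!sumrB -big_split; apply: eq_bigr => y _ /=.
  rewrite outerE !mxE !eqxx /= rmorphB /= !conjC_nat -/(g x y).
  rewrite ![j == _]eq_sym ![l == _]eq_sym; ring.
under [X in _ + X]eq_bigr => x _ do rewrite -!mulr_sumr.
rewrite !sumrB !sum_delta; under [X in _ + _ * X]eq_bigr do rewrite gC.
rewrite (gC l j) /g -mulr_suml.
by field.
Qed.

(** Equal fibre sizes make the two lists of values rearrangements of each other. For arcs, the
    cycles of [s] split a balanced digraph into closed trails. *)
Lemma balanced_perm (T : eqType) n (src tgt : 'I_n -> T) :
  (forall j, #|[pred x | src x == j]| = #|[pred x | tgt x == j]|) ->
  exists s : 'S_n, forall x, src (s x) = tgt x.
Proof.
move=> bal; have cnt (f : 'I_n -> T) j :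
    count_mem j [tuple f x | x < n] = #|[pred x | f x == j]|.
  by rewrite count_map /= enumT cardE /enum_mem size_filter; apply: eq_count.
have /tuple_permP[s sE] : perm_eq [tuple tgt x | x < n] [tuple src x | x < n].
  by apply/allP => k _; rewrite /= !cnt bal.
exists s => x; have /val_inj/(congr1 (fun t => tnth t x)) := sE.
by rewrite !tnth_mktuple => ->.
Qed.

Lemma sum_grid2 (R : pzRingType) (b : nat) (F : gridV 2 b -> R) :
  \sum_u F u = \sum_j F (0, j) + \sum_j F (1, j).
Proof.
transitivity (\sum_i \sum_j F (i, j)).
  by rewrite pair_bigA; apply: eq_bigr => -[].
rewrite !big_ord_recl big_ord0 addr0; congr (_ + _).
by apply: eq_bigr => j _; congr (F (_, j)); apply: val_inj.
Qed.

(** * Sufficiency of the degree condition *)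

Lemma separable_cone_lapmx (C : numClosedFieldType) (b : nat) (e : rel (gridV 2 b)) :
  simple_graph e -> deg e =1 deg (gamma e) -> separable_cone (lapmx C e).
Proof.
move=> [sym_e irr_e] deg_eq.
(* Edges within row 0 are fixed by [gamma] and cancel; what remains equates arcs leaving [j] with
   arcs entering it. *)
have out_in (j : 'I_b) : \sum_l (e (0, j) (1, l))%:R = \sum_l (e (1, j) (0, l))%:R :> C.
  have /(congr1 (fun n => n%:R : C)) := deg_eq (0, j).
  by rewrite !natr_deg !sum_grid2 => /addrI.
pose E := [set p : 'I_b * 'I_b | e (0, p.1) (1, p.2)].
pose src (x : 'I_#|E|) := (enum_val x).1; pose tgt (x : 'I_#|E|) := (enum_val x).2.
have arc_sum (F : 'I_b -> 'I_b -> C) :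
    \sum_x F (src x) (tgt x) = \sum_i \sum_j (e (0, i) (1, j))%:R * F i j.
  transitivity (\sum_(p in E) F p.1 p.2); first exact/esym/big_enum_val.
  rewrite big_mkcond pair_bigA /=.
  by apply: eq_bigr => p _; rewrite inE; case: ifP => _; rewrite ?mul1r ?mul0r.
have out_deg j l : \sum_x (src x == j)%:R * (src x == l)%:R
    = (j == l)%:R * \sum_k (e (0, j) (1, k))%:R :> C.
  rewrite (arc_sum (fun i _ => (i == j)%:R * (i == l)%:R)).
  under eq_bigr => i _ do rewrite -mulr_suml mulrCA.
  by rewrite sum_delta mulrC.
have in_deg j : \sum_x (tgt x == j)%:R = \sum_k (e (1, j) (0, k))%:R :> C.
  rewrite (arc_sum (fun _ i => (i == j)%:R)); apply: eq_bigr => i _.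
  under eq_bigr => k _ do rewrite mulrC.
  by rewrite sum_delta sym_e.
have cardE n (f : 'I_n -> 'I_b) j :
    #|[pred x | f x == j]|%:R = \sum_x (f x == j)%:R :> C.
  rewrite -sum1_card natr_sum big_mkcond; apply: eq_bigr => x _.
  by rewrite inE; case: eqP.
have [s srcs] : exists s : 'S_#|E|, forall x, src (s x) = tgt x.
  apply: balanced_perm => j; apply/eqP; rewrite -(eqr_nat C) !cardE in_deg -out_in.
  have := out_deg j j; rewrite eqxx mul1r => <-; apply/eqP.
  by apply: eq_bigr => x _; case: eqP; rewrite ?mulr1 ?mulr0.
pose rows : 'M[C]_(2 * b) := \sum_i \sum_x \sum_y ((e (i, x) (i, y))%:R / 2) *:
  kron (outer (delta_mx 0 i)) (outer (delta_mx 0 x - delta_mx 0 y)).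
rewrite -(subrK rows (lapmx C e)); apply: separable_coneD; last first.
  do 3![apply: separable_cone_sum => ?].
  by apply: separable_coneZ (separable_cone_outer _ _); rewrite divr_ge0 ?ler0n.
have rowsE (u v : gridV 2 b) :
    rows (mxvec_index u.1 u.2) (mxvec_index v.1 v.2) = (u.1 == v.1)%:R *
      ((u.2 == v.2)%:R * (\sum_x (e u (u.1, x))%:R) - (e u (u.1, v.2))%:R).
  case: u v => [i j] [i' l] /=; rewrite summxE.
  transitivity (\sum_k (k == i)%:R * ((k == i')%:R * ((j == l)%:R *
      (\sum_x (e (k, j) (k, x))%:R) - (e (k, j) (k, l))%:R) : C)).
    apply: eq_bigr => k _; rewrite summxE.
    rewrite -(sum_edge_outer C (f := fun x y => e (k, x) (k, y)) j l) => [|x y];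
      last exact: sym_e.
    rewrite !mulr_sumr; apply: eq_bigr => x _; rewrite summxE !mulr_sumr.
    apply: eq_bigr => y _; rewrite mxE kronE [outer (delta_mx 0 k) _ _]outerE !mxE.
    rewrite !eqxx /= conjC_nat ![_ == k]eq_sym; ring.
  by rewrite sum_delta.
(* Without the edges inside rows, the diagonal blocks hold the out- and in-degrees of the arcs,
   equal by balance, and the other blocks hold minus the arc matrix and its transpose. *)
apply: (separable_cone_perm (src := src) (s := s)) => -[i j] [i' l].
have arc_entry k m : \sum_x (src x == k)%:R * (src (s x) == m)%:R
    = (e (0, k) (1, m))%:R :> C.
  under eq_bigr => x _ do rewrite srcs.
  rewrite (arc_sum (fun p q => (p == k)%:R * (q == m)%:R)).
  under eq_bigr => p _ do under eq_bigr => q _ do rewrite mulrC -mulrA.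
  under eq_bigr => p _ do rewrite -mulr_sumr sum_delta.
  by rewrite sum_delta.
rewrite mxE [(- rows) _ _]mxE (lapmxE _ _ (i, j) (i', l)) (rowsE (i, j) (i', l)).
rewrite natr_deg sum_grid2 xpair_eqE /=.
have ord2 (k : 'I_2) : k = 0 \/ k = 1.
  by case: k => [[|[|//]] ?]; [left | right]; apply: val_inj.
case: (ord2 i) => ->; case: (ord2 i') => -> /=.
- by rewrite out_deg; ring.
- by rewrite arc_entry; ring.
- under [X in _ = - X]eq_bigr => x _ do rewrite mulrC.
  by rewrite arc_entry sym_e; ring.
- by rewrite out_deg out_in; ring.
Qed.

(** * Normalisation and the equivalence *)

Lemma tr_rho (C : numClosedFieldType) (a b : nat) (e : rel (gridV a b)) :
  simple_graph e -> (0 < nedges e)%N -> \tr (rho C e) = 1.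
Proof.
move=> simple_e m_gt0; have [_ irr_e] := simple_e.
rewrite mxtraceZ /mxtrace; under eq_bigr => k _ do
  rewrite !mxE eqxx mul1r irr_e subr0.
rewrite -(reindex (@pidx a b) (P := xpredT) (F := fun u => (deg e u)%:R)) /=.
  by rewrite -natr_sum sum_deg // mulVf // pnatr_eq0 muln_eq0 -lt0n.
exact/onW_bij/pidx_bij.
Qed.

Theorem mainTheorem5 (C : numClosedFieldType) (b : nat) (e : rel (gridV 2 b)) :
  (2 <= b)%N -> simple_graph e -> (0 < nedges e)%N ->
  (separable (rho C e) <-> degmx C e = degmx C (gamma e)).
Proof.
move=> b_ge2 simple_e m_gt0; split; first exact: separable_degmx.
move=> /degmx_eq deg_eq.
apply: separable_of_cone => //; first exact: ltnW; last exact: tr_rho.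
apply: separable_coneZ; first by rewrite invr_ge0 ler0n.
exact: separable_cone_lapmx.
Qed.
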